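(* Let $R>r>0$, let $\mathcal{T}\subset\mathbb{R}^3$ be the torus with radii $R,r$, let $d\ge 0$ be an integer, and let $X=\{\boldsymbol{x}_1,\ldots,\boldsymbol{x}_n\}\subset\mathcal{T}$ be a set of pairwise distinct nodes with fill distance $h_{X,\mathcal{T}}$. Let $\Sigma=\{\sigma_1,\ldots,\sigma_L\}$ be a family of stencils $\sigma_j=\{\boldsymbol{x}_{j_1},\ldots,\boldsymbol{x}_{j_{m_d}}\}\subset X$, each unisolvent for $\mathcal{H}_d(\mathcal{T})$, which covers the node set, i.e. $X=\bigcup_{j=1}^L\sigma_j$. Assume that the support radii are chosen as $$R_j=\operatorname{diam}_E(\sigma_j)+H,\qquad j=1,\ldots,L,\qquad\text{with } H>h_{X,\mathcal{T}}.$$ Then $J_{\boldsymbol{x}}\ne\emptyset$ for every $\boldsymbol{x}\in\mathcal{T}$. Consequently, for every $\mu>0$, the denominator $$\sum_{k\in J_{\boldsymbol{x}}}\omega_{\mu,k}(\boldsymbol{x})$$ of the normalized compact weights is strictly positive at every $\boldsymbol{x}\in\mathcal{T}\setminus X$.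
   Context: For $R>r>0$, the torus is $\mathcal{T}=\{(x,y,z)\in\mathbb{R}^3:(\sqrt{x^2+y^2}-R)^2+z^2=r^2\}$. $\mathcal{H}_d(\mathcal{T})=\{p|_{\mathcal{T}}:p \text{ a real polynomial in } x,y,z \text{ of total degree}\le d\}$ and $m_d=\dim\mathcal{H}_d(\mathcal{T})$. A set of $m_d$ pairwise distinct points of $\mathcal{T}$ is unisolvent for $\mathcal{H}_d(\mathcal{T})$ if for arbitrary prescribed real values at these points there is exactly one element of $\mathcal{H}_d(\mathcal{T})$ taking these values. $d_E(\boldsymbol{x},\boldsymbol{y})=\|\boldsymbol{x}-\boldsymbol{y}\|_2$ is the Euclidean distance of $\mathbb{R}^3$, and $\operatorname{diam}_E(\sigma)=\max_{\boldsymbol{x},\boldsymbol{y}\in\sigma}d_E(\boldsymbol{x},\boldsymbol{y})$. The fill distance is $h_{X,\mathcal{T}}=\sup_{\boldsymbol{x}\in\mathcal{T}}\min_{\boldsymbol{x}_i\in X}d_E(\boldsymbol{x},\boldsymbol{x}_i)$. For a stencil $\sigma_j$ with support radius $R_j>0$ and for $\mu>0$, the unnormalized compact multinode function is, for $\boldsymbol{x}\in\mathcal{T}\setminus X$, $$\omega_{\mu,j}(\boldsymbol{x})=\prod_{\ell=1}^{m_d}\left(\frac{1}{d_E(\boldsymbol{x},\boldsymbol{x}_{j_\ell})}-\frac{1}{R_j}\right)_+^{\mu},\qquad (t)_+=\max\{t,0\}.$$ Set $C_j=\bigcap_{\ell=1}^{m_d}\{\boldsymbol{\xi}\in\mathcal{T}:d_E(\boldsymbol{\xi},\boldsymbol{x}_{j_\ell})\le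 R_j\}$, let $\overset{\circ}{C}_j$ be the interior of $C_j$ in $\mathcal{T}$, and for $\boldsymbol{x}\in\mathcal{T}$ define the active index set $J_{\boldsymbol{x}}=\{j\in\{1,\ldots,L\}:\boldsymbol{x}\in\overset{\circ}{C}_j\}$. The normalized compact weights are $\widetilde W_{\mu,j}(\boldsymbol{x})=\omega_{\mu,j}(\boldsymbol{x})/\sum_{k\in J_{\boldsymbol{x}}}\omega_{\mu,k}(\boldsymbol{x})$ for $j\in J_{\boldsymbol{x}}$ and $0$ otherwise. *)

(* Defs.v *)
From HB Require Import structures.
From mathcomp Require Import all_boot all_order all_algebra.
From mathcomp Require Import all_classical all_reals all_analysis.
(* Its notations clash with those of MathComp-Analysis. *)
From mathcomp Require Import (canonicals, coercions) mpoly.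

Set Implicit Arguments.
Unset Strict Implicit.
Unset Printing Implicit Defensive.

Import Order.TTheory GRing.Theory Num.Theory.
Import numFieldNormedType.Exports.

Local Open Scope classical_set_scope.
Local Open Scope ring_scope.

Section Dimension.
Context {K : realType} {V : lmodType K}.
Implicit Types (H : set V).

Definition is_basis H m (b : 'I_m -> V) : Prop :=
  H = [set \sum_(i < m) c i *: b i | c in [set: 'I_m -> K]] /\
  (forall c : 'I_m -> K, \sum_(i < m) c i *: b i = 0 -> forall i, c i = 0).

(* 0 when H has no finite basis; see [lin_dimE], and [Hd_basis] for the spaces used here. *)
Definition lin_dim H : nat := xget 0%N [set m | exists b : 'I_m -> V, is_basis H b].

Lemma finite_span_basis H N (g : 'I_N -> V) :
  H = [set \sum_(i < N) c i *: g i | c in [set: 'I_N -> K]] ->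
  exists m (b : 'I_m -> V), is_basis H b.
Proof.
elim: N g => [|N IH] g HE.
  by exists 0%N, g; split=> // c _ [].
have [fr|/existsNP[c /not_implyP[c0 /existsNP[k /eqP ck]]]] := pselect
  (forall c : 'I_N.+1 -> K, \sum_i c i *: g i = 0 -> forall i, c i = 0).
  by exists N.+1, g.
apply: (IH (fun i => g (lift k i))); rewrite HE.
have gk : g k = \sum_(i < N) (- (c k)^-1 * c (lift k i)) *: g (lift k i).
  move: c0; rewrite (bigD1_ord k) //= => /eqP; rewrite addr_eq0 => /eqP h.
  rewrite -[LHS](scalerK ck) h scalerN scaler_sumr -sumrN; apply: eq_bigr => i _.
  by rewrite scalerA mulNr scaleNr.
apply/seteqP; split=> [_ [e _ <-]|_ [e _ <-]].
  exists (fun i => e (lift k i) - e k * ((c k)^-1 * c (lift k i))) => //.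
  rewrite (bigD1_ord k) //= gk scaler_sumr -big_split /=; apply: eq_bigr => i _.
  by rewrite scalerA -scalerDl addrC mulNr mulrN.
exists (fun i => if unlift k i is Some j then e j else 0) => //.
rewrite (bigD1_ord k) //= unlift_none scale0r add0r.
by apply: eq_bigr => i _; rewrite liftK.
Qed.

Lemma basis_leq H m n (b : 'I_m -> V) (g : 'I_n -> V) :
  is_basis H b -> is_basis H g -> (m <= n)%N.
Proof.
move=> [Hb fb] [Hg _].
have key i : exists c : 'I_n -> K, \sum_(j < n) c j *: g j = b i.
  have : H (b i).
    rewrite Hb; exists (fun j => (j == i)%:R) => //.
    rewrite (bigD1 i) //= eqxx scale1r big1 ?addr0 // => j /negbTE ->.
    by rewrite scale0r.
  by rewrite Hg => -[c _ <-]; exists c.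
pose A : 'M[K]_(m, n) := \matrix_(i, j) projT1 (cid (key i)) j.
have Ab i : b i = \sum_j A i j *: g j.
  by rewrite -[LHS](projT2 (cid (key i))); apply: eq_bigr => j _; rewrite mxE.
suff : row_free A by rewrite /row_free => /eqP <-; exact: rank_leq_col.
apply/row_freeP; apply: contrapT => nA.
have : kermx A != 0.
  by apply/negP => /eqP k0; apply: nA; apply/row_freeP; rewrite -kermx_eq0 k0.
move=> /rowV0Pn[v /sub_kermxP vA /eqP]; apply.
apply/rowP => i; rewrite mxE; apply: (fb (fun i => v 0 i)).
transitivity (\sum_j (v *m A) 0 j *: g j); last first.
  by rewrite vA big1 // => j _; rewrite mxE scale0r.
under eq_bigr do rewrite Ab scaler_sumr.
rewrite exchange_big; apply: eq_bigr => j _; rewrite mxE scaler_suml.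
by apply: eq_bigr => k _; rewrite scalerA.
Qed.

Lemma lin_dimE H m (b : 'I_m -> V) : is_basis H b -> lin_dim H = m.
Proof.
move=> Hb; rewrite /lin_dim; case: xgetP => [p -> [g Hg]|/(_ m)[]]; last by exists b.
by apply/eqP; rewrite eqn_leq (basis_leq Hg Hb) (basis_leq Hb Hg).
Qed.

End Dimension.

Section Torus.
Context {K : realType}.

Definition dE (x y : 'rV[K]_3) : K := Num.sqrt (\sum_(i < 3) (x 0 i - y 0 i) ^+ 2).

(* Used below as a type through the coercion [set_type], which carries the
   topology induced by the ambient space. *)
Definition torus (R r : K) : set 'rV[K]_3 :=
  [set x | (Num.sqrt (x 0 0 ^+ 2 + x 0 1 ^+ 2) - R) ^+ 2 + x 0 2 ^+ 2 = r ^+ 2].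

Context {R r : K}.
Local Notation T := (torus R r).

Definition dT (x y : T) : K := dE (val x) (val y).

Definition poly_restr (p : mpoly.mpoly 3 K) : T -> K^o :=
  fun x => mpoly.meval (fun i => val x 0 i) p.

(* [msize p] is the total degree plus one, and 0 for p = 0. *)
Definition Hd (d : nat) : set (T -> K^o) :=
  [set poly_restr p | p in [set p | (mpoly.msize p <= d.+1)%N]].

Definition Hd_dim (d : nat) : nat := lin_dim (Hd d).

Definition unisolvent m (H : set (T -> K^o)) (s : 'I_m -> T) : Prop :=
  m = lin_dim H /\ injective s /\
  forall v : 'I_m -> K, exists! f : T -> K^o, H f /\ forall l, f (s l) = v l.

(* The empty minimum is +oo, so no real number exceeds the fill distance of
   the empty node set. *)
Definition fill_distance n (X : 'I_n -> T) : \bar K :=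
  ereal_sup [set \big[mine/+oo%E]_(i < n) (dT x (X i))%:E | x in [set: T]].

Definition diamE m (s : 'I_m -> T) : K :=
  \big[Num.max/0]_(k < m) \big[Num.max/0]_(l < m) dT (s k) (s l).

(* Meaningful at x off the nodes only: at a node the inverse is 0. *)
Definition compact_multinode (mu : K) m (s : 'I_m -> T) (rho : K) (x : T) : K :=
  \prod_(l < m) (Num.max ((dT x (s l))^-1 - rho^-1) 0) `^ mu.

Definition common_ball m (s : 'I_m -> T) (rho : K) : set T :=
  \bigcap_(l in [set: 'I_m]) [set xi | dT xi (s l) <= rho].

Definition active L m (s : 'I_L -> 'I_m -> T) (rho : 'I_L -> K) (x : T) : set 'I_L :=
  [set j | (common_ball (s j) (rho j))° x].

Definition weight_denom (mu : K) L m (s : 'I_L -> 'I_m -> T) (rho : 'I_L -> K)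
    (x : T) : K :=
  \sum_(k < L | k \in active s rho x) compact_multinode mu (s k) (rho k) x.

Lemma Hd_basis d : exists b : 'I_(Hd_dim d) -> (T -> K^o), is_basis (Hd d) b.
Proof.
rewrite /Hd_dim.
suff [m [b Hb]] : exists m (b : 'I_m -> (T -> K^o)), is_basis (Hd d) b.
  by rewrite (lin_dimE Hb); exists b.
pose I : finType := mpoly.bmultinom 3 d.+1.
pose mon (i : I) := mpoly.mpolyX K (mpoly.bmnm i).
apply: (@finite_span_basis _ _ _ #|I| (fun i => poly_restr (mon (enum_val i)))).
have restr_sum (c : I -> K) :
    poly_restr (\sum_i c i *: mon i) = \sum_i c i *: poly_restr (mon i).
  apply/funext => x; rewrite fct_sumE /poly_restr raddf_sum /=.
  by apply: eq_bigr => i _; rewrite mpoly.mevalZ.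
apply/seteqP; split=> [_ [p /= pd <-]|_ [c _ <-]].
  exists (fun i => mpoly.mcoeff (mpoly.bmnm (enum_val i)) p) => //.
  rewrite [in RHS](mpoly.mpolywE pd) restr_sum.
  by rewrite [RHS](reindex _ (onW_bij _ (enum_val_bij I))).
exists (\sum_(i : I) c (enum_rank i) *: mon i); last first.
  rewrite restr_sum (reindex _ (onW_bij _ (enum_val_bij I))) /=.
  by apply: eq_bigr => i _; rewrite enum_valK.
rewrite /=; apply: (leq_trans (mpoly.msize_sum _ _ _)).
apply/bigmax_leqP => i _; apply: (leq_trans (mpoly.msizeZ_le _ _)).
by rewrite mpoly.msizeX; exact: mpoly.bmdeg.
Qed.

End Torus.

Arguments Hd {K} R r d.
Arguments Hd_dim {K} R r d.

(* Main.v *)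
(* Each x has a node X i at distance < H; a stencil sigma j containing X i has
   all its nodes within diamE (sigma j) of X i, so by the triangle inequality
   all of them lie at distance < rho j from x. Strictness makes x interior to the
   common ball and every factor of the multinode function positive. *)
Require Import Defs.
From mathcomp Require Import all_boot all_order all_algebra.
From mathcomp Require Import all_classical all_reals all_analysis.
From mathcomp Require Import ring lra.

Import Order.TTheory GRing.Theory Num.Theory.
Import numFieldNormedType.Exports.

Local Open Scope classical_set_scope.
Local Open Scope ring_scope.

(** Induction on [n]: with the first coordinate split off, only the cross term remains to be bounded
    beyond the induction hypothesis. *)
Lemma cauchy_schwarz (K : realDomainType) n (a b : 'I_n -> K) :
  (\sum_i a i * b i) ^+ 2 <= (\sum_i a i ^+ 2) * (\sum_i b i ^+ 2).
Proof.
elim: n a b => [|n IH] a b; first by rewrite !big_ord0 expr0n mul0r.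
rewrite !big_ord_recl.
have {IH} := IH (fun i => a (lift ord0 i)) (fun i => b (lift ord0 i)).
set s := \sum_i _ * _; set A := \sum_i a _ ^+ 2; set B := \sum_i b _ ^+ 2.
set x := a _; set y := b _ => sAB.
have A0 : 0 <= A by apply: sumr_ge0 => i _; exact: sqr_ge0.
have B0 : 0 <= B by apply: sumr_ge0 => i _; exact: sqr_ge0.
(* AM-GM applied to x^2 B and y^2 A, as s^2 <= A B *)
suff : 2 * (x * y * s) <= x ^+ 2 * B + A * y ^+ 2.
  have -> : (x * y + s) ^+ 2 = (x * y) ^+ 2 + 2 * (x * y * s) + s ^+ 2 by ring.
  have -> : (x ^+ 2 + A) * (y ^+ 2 + B) =
      (x * y) ^+ 2 + (x ^+ 2 * B + A * y ^+ 2) + A * B by ring.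
  lra.
have Q0 : 0 <= x ^+ 2 * B + A * y ^+ 2.
  by rewrite addr_ge0 // mulr_ge0 // sqr_ge0.
(* The cross term may be negative, so its absolute value is bounded, by comparing squares with [(u +
   v) ^+ 2 = (u - v) ^+ 2 + 4 * (u * v)]. *)
apply: le_trans (ler_norm _) _.
rewrite -(@ler_pXn2r _ 2) ?nnegrE // -normrX ger0_norm ?sqr_ge0 //.
have : (x * y) ^+ 2 * s ^+ 2 <= (x * y) ^+ 2 * (A * B).
  by rewrite ler_wpM2l ?sqr_ge0.
have -> : (2 * (x * y * s)) ^+ 2 = 4 * ((x * y) ^+ 2 * s ^+ 2) by ring.
have -> : (x ^+ 2 * B + A * y ^+ 2) ^+ 2 =
    (x ^+ 2 * B - A * y ^+ 2) ^+ 2 + 4 * ((x * y) ^+ 2 * (A * B)) by ring.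
have : 0 <= (x ^+ 2 * B - A * y ^+ 2) ^+ 2 by exact: sqr_ge0.
lra.
Qed.

(** Squaring both sides and cancelling the pure squares leaves Cauchy-Schwarz for the cross term. *)
Lemma minkowski2 (K : rcfType) n (a b : 'I_n -> K) :
  Num.sqrt (\sum_i (a i + b i) ^+ 2) <=
  Num.sqrt (\sum_i a i ^+ 2) + Num.sqrt (\sum_i b i ^+ 2).
Proof.
have sq_ge0 (c : 'I_n -> K) : 0 <= \sum_i c i ^+ 2.
  by apply: sumr_ge0 => i _; exact: sqr_ge0.
rewrite -(@ler_pXn2r _ 2) ?nnegrE ?addr_ge0 ?sqrtr_ge0 // [leRHS]sqrrD !sqr_sqrtr //.
rewrite -sqrtrM // (eq_bigr _ (fun i _ => sqrrD (a i) (b i))) !big_split /=.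
rewrite lerD2r lerD2l -mulr2n lerMn2r /=.
apply: le_trans (ler_norm _) _; rewrite -sqrtr_sqr ler_sqrt ?mulr_ge0 //.
exact: cauchy_schwarz.
Qed.

Section Distance.
Context {K : realType} {R r : K}.
Implicit Types x y z : torus R r.

Lemma dT_ge0 x y : 0 <= dT x y.
Proof. exact: sqrtr_ge0. Qed.

Lemma dT_triangle y x z : dT x z <= dT x y + dT y z.
Proof.
(* Each coordinate difference is split through [y], to fit [minkowski2]. *)
rewrite /dT /dE (eq_bigr _ (fun i _ => congr1 (fun t => t ^+ 2)
  (esym (subrKA (val y 0 i) (val x 0 i) (- val z 0 i))))).
exact: minkowski2.
Qed.

Lemma dT_eq0 x y : dT x y = 0 -> x = y.
Proof.
(* [Num.sqrt] vanishes on negative numbers too, so this only gives that the sum is at most 0;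
   nonnegativity of the squares does the rest. *)
move=> /eqP; rewrite sqrtr_eq0 => xy0; apply/val_inj/rowP => i; apply/eqP.
rewrite -subr_eq0 -sqrf_eq0; apply/eqP.
have sq_ge0 j : true -> 0 <= (val x 0 j - val y 0 j) ^+ 2 by rewrite sqr_ge0.
apply: (psumr_eq0P sq_ge0) => //.
by apply/eqP; rewrite eq_le xy0 sumr_ge0.
Qed.

Lemma dT_continuous y : continuous (dT^~ y).
Proof.
move=> x; apply: continuous_comp; last exact: sqrt_continuous.
apply: cvg_big => [||i _]; [exact: add_continuous|exact: nbhs_filter|].
apply: (@continuous_comp _ _ _ (fun z : torus R r => val z 0 i - val y 0 i)
  (fun t : K => t ^+ 2)); last exact: exprn_continuous.
suff coord : (fun z : torus R r => val z 0 i : K) @ x --> (val x 0 i : K).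
  exact: cvgB coord (cvg_cst _).
(* The torus carries the initial topology of [val], which makes the inclusion continuous. *)
apply: (@cvg_comp _ _ _ (val : torus R r -> 'rV[K]_3) (fun v => v 0 i)).
  exact: initial_continuous.
exact: coord_continuous.
Qed.

Lemma dT_diamE m (s : 'I_m -> torus R r) k l : dT (s k) (s l) <= diamE s.
Proof.
by apply: (bigmax_sup k) => //; exact: (le_bigmax _ (fun l => dT (s k) (s l))).
Qed.

Lemma dT_fill n (X : 'I_n -> torus R r) (H : K) x :
  (fill_distance X < H%:E)%E -> exists i, dT x (X i) < H.
Proof.
move=> XH; have : (\big[mine/+oo]_(i < n) (dT x (X i))%:E < H%:E)%E.
  by apply: le_lt_trans XH; apply: ereal_sup_ubound; exists x.
(* The alternative that the default value [+oo] is below [H] is absurd; this also excludes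
   [n = 0]. *)
by case/bigmin_ltP => [//|[i _]]; rewrite lte_fin; exists i.
Qed.

(** Finitely many strict inequalities between continuous functions persist on a neighbourhood. *)
Lemma interior_common_ball m (s : 'I_m -> torus R r) (rho : K) x :
  (forall l, dT x (s l) < rho) -> (common_ball s rho)° x.
Proof.
move=> xs; have : \forall y \near x, forall l, dT y (s l) < rho.
  apply: (filter_forall (nbhs_filter x)) => l.
  exact: (dT_continuous (s l) x _ (lt_nbhsl (xs l))).
by apply: filterS => y ys l _; apply: ltW.
Qed.

Lemma compact_multinode_ge0 (mu : K) m (s : 'I_m -> torus R r) (rho : K) x :
  0 <= compact_multinode mu s rho x.
Proof. by apply: prodr_ge0 => l _; exact: powR_ge0. Qed.

(** Off the stencil all distances are positive, so inversion reverses [dT x (s l) < rho] and every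
    base is positive. *)
Lemma compact_multinode_gt0 (mu : K) m (s : 'I_m -> torus R r) (rho : K) x :
  ~ range s x -> (forall l, dT x (s l) < rho) ->
  0 < compact_multinode mu s rho x.
Proof.
move=> sx xs; apply: prodr_gt0 => l _; apply: powR_gt0.
have dx : 0 < dT x (s l).
  rewrite lt_def dT_ge0 andbT; apply/eqP => /dT_eq0 xl.
  by apply: sx; exists l.
rewrite lt_max subr_gt0 ltf_pV2 ?posrE ?xs //.
exact: lt_trans dx (xs l).
Qed.

End Distance.

Theorem lemma1 (K : realType) (R r : K) (r_gt0 : 0 < r) (r_lt_R : r < R) (d : nat)
    (n : nat) (X : 'I_n -> torus R r) (X_inj : injective X)
    (L : nat) (sigma : 'I_L -> 'I_(Hd_dim R r d) -> torus R r)
    (sigma_X : forall j, range (sigma j) `<=` range X)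
    (sigma_unisolvent : forall j, unisolvent (Hd R r d) (sigma j))
    (sigma_cover : range X = \bigcup_(j in [set: 'I_L]) range (sigma j))
    (H : K) (H_gt_fill : (fill_distance X < H%:E)%E)
    (rho : 'I_L -> K) (rhoE : forall j, rho j = diamE (sigma j) + H) :
  (forall x : torus R r, active sigma rho x !=set0) /\
  (forall mu : K, 0 < mu -> forall x : torus R r, ~ range X x ->
     0 < weight_denom mu sigma rho x).
Proof.
have near_stencil x : exists j, forall l, dT x (sigma j l) < rho j.
  have [i xi] := dT_fill _ _ _ x H_gt_fill.
  have : range X (X i) by exists i.
  rewrite sigma_cover => -[j _ [k _ ki]]; exists j => l.
  apply: le_lt_trans (dT_triangle (X i) _ _) _.
  by rewrite rhoE addrC -ki ler_ltD ?dT_diamE // ki.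
split=> [x|mu _ x Xx]; have [j xj] := near_stencil x.
  by exists j; exact: interior_common_ball.
have j_active : j \in active sigma rho x.
  by rewrite inE; exact: interior_common_ball.
(* The term of [j] is positive and the others are nonnegative; by [sigma_X], a point off [X] is off
   the stencil of [j]. *)
rewrite /weight_denom (bigD1 j) //= ltr_pwDl //.
  by apply: compact_multinode_gt0 => // /sigma_X.
by apply: sumr_ge0 => k _; exact: compact_multinode_ge0.
Qed.
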